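(* Let $d,k$ be positive integers and let $B_d^k$ be the $kd\times kd$ matrix made of $k\times k$ blocks of size $d\times d$, in which the diagonal blocks are $d\times d$ identity matrices and all entries of the off-diagonal blocks are equal to $\frac{1}{\sqrt d}$. There exists a set of $k$ mutually unbiased bases in $\mathbb{C}^d$ if and only if $\mathrm{rank}_\theta^{\mathrm{psd}}(B_d^k)=d$.
   Context: For a symmetric matrix $A\in\mathbb{R}^{n\times n}$ with nonnegative entries, its psd-phaseless rank is $\mathrm{rank}_\theta^{\mathrm{psd}}(A)=\min\{\mathrm{rank}(B) : B\in\mathbb{C}^{n\times n},\ |B_{ij}|=A_{ij}\text{ for all }i,j,\ B\succeq0\}$, where $B\succeq 0$ means that $B$ is Hermitian positive semidefinite. Two orthonormal bases $\{u_1,\dots,u_d\}$ and $\{v_1,\dots,v_d\}$ of $\mathbb{C}^d$ are unbiased if $|u_i^*v_j|=\frac{1}{\sqrt d}$ for all $i,j$. A set of orthonormal bases is a set of mutually unbiased bases if all pairs of distinct bases in it are unbiased. *)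

(* Defs.v *)
From HB Require Import structures.
From mathcomp Require Import all_boot all_order all_algebra.
From mathcomp Require Import finmap complex reals.

Set Implicit Arguments.
Unset Strict Implicit.
Unset Printing Implicit Defensive.
Import Order.TTheory GRing.Theory Num.Theory.
Local Open Scope ring_scope.
Local Open Scope complex_scope.
Local Open Scope sesquilinear_scope.

(* The complex numbers are R[i] with R : realType; on R[i], `|z| is the modulus
   seen as an element of R[i], and 0 <= z means that z is real and nonnegative. *)

Definition psdmx (R : realType) (n : nat) (B : 'M[R[i]]_n) : Prop :=
  B \is hermsymmx /\ forall x : 'cV[R[i]]_n, 0 <= (x ^t* *m B *m x) 0 0.

Definition psd_phasing (R : realType) (n : nat) (A : 'M[R]_n)
    (B : 'M[R[i]]_n) : Prop :=
  (forall i j, `|B i j| = (A i j)%:C) /\ psdmx B.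

(* "The psd-phaseless rank of A is r". This is a relation because the minimum
   does not exist when A has no psd phasing, as for A = [0 1; 1 0]. *)
Definition is_psd_phaseless_rank (R : realType) (n : nat) (A : 'M[R]_n)
    (r : nat) : Prop :=
  (exists2 B : 'M[R[i]]_n, psd_phasing A B & \rank B = r) /\
  (forall B : 'M[R[i]]_n, psd_phasing A B -> (r <= \rank B)%N).

Lemma is_psd_phaseless_rank_uniq (R : realType) (n : nat) (A : 'M[R]_n) r s :
  is_psd_phaseless_rank A r -> is_psd_phaseless_rank A s -> r = s.
Proof.
move=> [[B pB <-] minB] [[C pC <-] minC].
by apply/eqP; rewrite eqn_leq minB ?minC.
Qed.

(* Its dimension \sum_(a < k) d is the one imposed by \mxblock; it is equal,
   but not convertible, to k * d. *)
Definition mub_matrix (R : realType) (d k : nat) : 'M[R]_(\sum_(a < k) d) :=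
  \mxblock_(a < k, b < k)
    (if a == b then 1%:M else const_mx (Num.sqrt d%:R)^-1 : 'M[R]_d).

Lemma mub_matrix_sym (R : realType) (d k : nat) :
  (mub_matrix R d k)^T = mub_matrix R d k.
Proof.
rewrite /mub_matrix tr_mxblock; apply/eq_mxblock => a b.
by rewrite eq_sym; case: eqP => _; rewrite ?trmx1 ?trmx_const.
Qed.

Lemma mub_matrix_ge0 (R : realType) (d k : nat) i j : 0 <= mub_matrix R d k i j.
Proof.
rewrite mxE; case: eqP => _; rewrite !mxE ?ler0n //.
by rewrite invr_ge0 sqrtr_ge0.
Qed.

(* The standard inner product u^* v, conjugate-linear in u. *)
Definition cdot (R : realType) (d : nat) (u v : 'cV[R[i]]_d) : R[i] :=
  (u ^t* *m v) 0 0.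

Section Bases.
Local Open Scope fset_scope.

(* An orthonormal basis is a set of vectors, without an order. *)
Definition orthonormal_basis (R : realType) (d : nat)
    (U : {fset 'cV[R[i]]_d}) : Prop :=
  basis_of fullv (enum_fset U) /\ {in U &, forall u v, cdot u v = (u == v)%:R}.

Definition unbiased (R : realType) (d : nat) (U V : {fset 'cV[R[i]]_d}) : Prop :=
  forall u v, u \in U -> v \in V -> `|cdot u v| = ((Num.sqrt d%:R)^-1)%:C.

Definition mutually_unbiased_bases (R : realType) (d : nat)
    (S : {fset {fset 'cV[R[i]]_d}}) : Prop :=
  (forall U, U \in S -> orthonormal_basis U) /\
  (forall U V, U \in S -> V \in S -> U != V -> unbiased U V).

End Bases.

(* Main.v *)
Require Import Defs.
From mathcomp Require Import all_boot all_order all_algebra.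
From mathcomp Require Import finmap complex reals.
From mathcomp Require Import ring.

(** The vectors of k orthonormal bases, placed side by side, form a matrix V
    with d rows, and the moduli of the entries of the Gram matrix V^* V are
    those of [mub_matrix R d k] exactly when the bases are mutually unbiased.
    Gram matrices are psd and V^* V has rank at most d, while d is a lower
    bound for the rank of any psd phasing, because each of its diagonal blocks
    is an identity matrix ([phasing_identity_block]).  This gives the direct
    implication.

    Conversely, let B be a psd phasing of rank d.  Since a diagonal block is
    the identity, the d rows of B through that block span its row space, and
    those rows themselves form a matrix V with B = V^* V
    ([hermitian_eq_gram]).  The columns of V, cut into k groups
    of d, are then the vectors of the bases.

    What remains is to pass between indexed families of vectors and sets of
    bases.  For d > 1 unbiased bases are distinct as sets, because
    1 / sqrt d <> 1.  For d = 1 this fails: all entries of the matrix have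
    modulus 1, and the bases read off B may all coincide.  But every set of k
    orthonormal bases of a line is mutually unbiased, and there are such sets
    for all k, because there are infinitely many complex numbers of modulus 1
    ([mubs_dim1]). *)

Set Implicit Arguments.
Unset Strict Implicit.
Unset Printing Implicit Defensive.
Local Open Scope ring_scope.
Import Order.TTheory GRing.Theory Num.Theory.
Local Open Scope sesquilinear_scope.

(** * Hermitian matrices with an identity principal submatrix *)

Lemma rank_ge_identity_block (F : fieldType) (n d : nat) (B : 'M[F]_n)
    (f : 'I_d -> 'I_n) :
  mxsub f f B = 1%:M -> (d <= \rank B)%N.
Proof.
move=> Bf1; rewrite -{1}(mxrank1 F d) -Bf1 -[X in mxsub f f X]mulmx1 mxsub_mul.
by rewrite rowsubE (leq_trans (mxrankM_maxl _ _)) ?mxrankM_maxr.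
Qed.

Lemma hermsymmxP (R : realType) (n : nat) (B : 'M[R[i]]_n) :
  B \is hermsymmx <-> B = B ^t*.
Proof.
split=> [/is_hermitianmxP|BE]; first by rewrite expr0 scale1r.
by apply/is_hermitianmxP; rewrite expr0 scale1r.
Qed.

(** The rows of B selected by f are independent, as they contain the identity,
    so by the bound on the rank they span the row space and B = X V for some X.
    Reading the columns selected by f gives X = colsub f B, which is V^* because
    B is Hermitian. *)
Lemma hermitian_eq_gram (R : realType) (n d : nat) (B : 'M[R[i]]_n)
    (f : 'I_d -> 'I_n) :
  B \is hermsymmx -> (\rank B <= d)%N -> mxsub f f B = 1%:M ->
  B = (rowsub f B) ^t* *m rowsub f B.
Proof.
move=> hB rB Bf1; set V := rowsub f B.
have V1 : colsub f V = 1%:M.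
  by rewrite -Bf1 /V; apply/matrixP=> i j; rewrite !mxE.
have rV : \rank V = d.
  apply/eqP; rewrite eqn_leq rank_leq_row -{1}(mxrank1 R[i] d) -V1.
  by rewrite -{1}[V]mulmx1 -mulmx_colsub mxrankM_maxl.
have VB : (V <= B)%MS by rewrite /V rowsubE submxMl.
have /submxP[X BX] : (B <= V)%MS.
  by rewrite -(mxrank_leqif_sup VB) eqn_leq rV rB -{1}rV mxrankS.
have -> : V ^t* = X; last exact: BX.
rewrite -[X]mulmx1 -V1 mulmx_colsub -BX /V.
move/hermsymmxP: hB => {2}->.
by apply/matrixP=> i j; rewrite !mxE.
Qed.

(** * Gram matrices *)

Lemma cdotE (R : realType) (d : nat) (u v : 'cV[R[i]]_d) :
  cdot u v = \sum_i (u i 0)^* * v i 0.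
Proof. by rewrite /cdot mxE; apply: eq_bigr => i _; rewrite !mxE. Qed.

Lemma conj_cdot (R : realType) (d : nat) (u v : 'cV[R[i]]_d) :
  (cdot u v)^* = cdot v u.
Proof.
rewrite !cdotE rmorph_sum; apply: eq_bigr => i _.
by rewrite rmorphM /= conjCK mulrC.
Qed.

Lemma cdot_sumr (R : realType) (d : nat) (I : finType) (x : 'cV[R[i]]_d)
    (c : I -> R[i]) (w : I -> 'cV[R[i]]_d) :
  cdot x (\sum_j c j *: w j) = \sum_j c j * cdot x (w j).
Proof.
rewrite /cdot mulmx_sumr summxE; apply: eq_bigr => j _.
by rewrite -scalemxAr mxE.
Qed.

Lemma gramE (R : realType) (d n : nat) (V : 'M[R[i]]_(d, n)) p q :
  (V ^t* *m V) p q = cdot (col p V) (col q V).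
Proof. by rewrite cdotE mxE; apply: eq_bigr => i _; rewrite !mxE. Qed.

Lemma gram_psd (R : realType) (d n : nat) (V : 'M[R[i]]_(d, n)) :
  psdmx (V ^t* *m V).
Proof.
split.
  apply/hermsymmxP/matrixP=> p q.
  by rewrite gramE [RHS]mxE [(_^T) p q]mxE gramE conj_cdot.
move=> x; have -> : x ^t* *m (V ^t* *m V) *m x = (V *m x) ^t* *m (V *m x).
  by rewrite trmx_mul map_mxM !mulmxA.
rewrite -/(cdot _ _) cdotE; apply: sumr_ge0 => i _.
by rewrite mulrC mul_conjC_ge0.
Qed.

Lemma psd_diag_ge0 (R : realType) (n : nat) (B : 'M[R[i]]_n) p :
  psdmx B -> 0 <= B p p.
Proof.
case=> _ /(_ (delta_mx p 0)); rewrite trmx_delta map_delta_mx.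
by rewrite -rowE -colE !mxE.
Qed.

(** * Psd phasings of the block matrix *)

Definition block_index (d k : nat) (a : 'I_k) (i : 'I_d) :
    'I_(\sum_(a < k) d) :=
  tagnat.Rank (p_ := fun _ => d) a i.

Lemma block_index1 (d k : nat) (a : 'I_k) (i : 'I_d) :
  tagnat.sig1 (block_index a i) = a.
Proof. exact: tagnat.Rank1K. Qed.

Lemma block_index2 (d k : nat) (a : 'I_k) (i : 'I_d) :
  tagnat.sig2 (block_index a i) = i :> 'I_d.
Proof. by apply: val_inj; rewrite /block_index tagnat.Rank2K. Qed.

Lemma block_indexK (d k : nat) (p : 'I_(\sum_(a < k) d)) :
  block_index (tagnat.sig1 p) (tagnat.sig2 p) = p.
Proof. exact: tagnat.sig2K. Qed.

Lemma mub_matrix_block_index (R : realType) (d k : nat) (a b : 'I_k)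
    (i j : 'I_d) :
  mub_matrix R d k (block_index a i) (block_index b j) =
  if a == b then (i == j)%:R else (Num.sqrt d%:R)^-1.
Proof.
rewrite mxE !block_index1; case: eqP => _; last by rewrite mxE.
by rewrite mxE !block_index2.
Qed.

(** The phasing prescribes only moduli; on the diagonal the phases are pinned
    down too, because the diagonal entries of a psd matrix are nonnegative. *)
Lemma phasing_identity_block (R : realType) (d k : nat) B (a : 'I_k) :
  psd_phasing (mub_matrix R d k) B ->
  mxsub (block_index a) (block_index a) B = 1%:M.
Proof.
case=> modB psdB; apply/matrixP=> i j; rewrite !mxE.
have := modB (block_index a i) (block_index a j).
rewrite mub_matrix_block_index eqxx.
have [<-|_ /normr0_eq0->//] := eqVneq i j.
by rewrite ger0_norm ?psd_diag_ge0.
Qed.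

(** Mutually unbiased bases with indices for the bases and for their vectors, as
    they appear among the columns of a matrix.  For d = 1 distinct indices may
    give the same basis. *)
Definition mub_family (R : realType) (d k : nat)
    (u : 'I_k -> 'I_d -> 'cV[R[i]]_d) : Prop :=
  (forall a i j, cdot (u a i) (u a j) = (i == j)%:R) /\
  (forall a b i j, a != b ->
     `|cdot (u a i) (u b j)| = ((Num.sqrt d%:R)^-1)%:C%C).

Lemma mub_family_of_phasing (R : realType) (d k : nat) B (a0 : 'I_k) :
  psd_phasing (mub_matrix R d k) B -> (\rank B <= d)%N ->
  exists u : 'I_k -> 'I_d -> 'cV[R[i]]_d, mub_family u.
Proof.
move=> pB rB; have [hB _] := pB.2.
have := hermitian_eq_gram hB rB (phasing_identity_block a0 pB).
set V := rowsub _ _ => BE.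
exists (fun a i => col (block_index a i) V); split=> [a i j|a b i j /negPf ab].
  rewrite -gramE -BE; move/matrixP/(_ i j): (phasing_identity_block a pB).
  by rewrite !mxE.
by rewrite -gramE -BE pB.1 mub_matrix_block_index ab.
Qed.

Lemma phaseless_rank_of_mub_family (R : realType) (d k : nat) (a0 : 'I_k)
    (u : 'I_k -> 'I_d -> 'cV[R[i]]_d) :
  mub_family u -> is_psd_phaseless_rank (mub_matrix R d k) d.
Proof.
move=> [onu unbu].
pose V : 'M[R[i]]_(d, \sum_(a < k) d) :=
  \matrix_(i, p) u (tagnat.sig1 p) (tagnat.sig2 p) i 0.
have colV a i : col (block_index a i) V = u a i.
  by apply/matrixP=> l z; rewrite !mxE block_index1 block_index2 (ord1 z).
have rank_ge B : psd_phasing (mub_matrix R d k) B -> (d <= \rank B)%N.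
  by move/(phasing_identity_block a0)/rank_ge_identity_block.
have pV : psd_phasing (mub_matrix R d k) (V ^t* *m V).
  split; last exact: gram_psd.
  move=> p q; rewrite -(block_indexK p) -(block_indexK q) gramE !colV.
  rewrite mub_matrix_block_index.
  have [->|ab] := eqVneq (tagnat.sig1 p) (tagnat.sig1 q); last exact: unbu.
  by rewrite onu normr_nat rmorph_nat.
split=> //; exists (V ^t* *m V) => //.
apply/eqP; rewrite eqn_leq rank_ge // andbT.
exact: leq_trans (mxrankM_maxr _ _) (rank_leq_row _).
Qed.

(** * From families of vectors to sets of bases *)

Lemma unit_norm_injection (C : numClosedFieldType) :
  exists2 c : nat -> C, injective c & forall n, `|c n| = 1.
Proof.
pose z n : C := 1 + n%:R * 'i.
have zJ n : (z n)^* = 1 - n%:R * 'i.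
  by rewrite rmorphD rmorphM /= rmorph1 conjCi conjC_nat mulrN.
have z0 n : z n != 0.
  have zD : z n + (z n)^* = 2%:R by rewrite zJ /z; ring.
  apply/eqP=> zn0; move/eqP: zD.
  by rewrite zn0 rmorph0 addr0 eq_sym pnatr_eq0.
have zJ0 n : (z n)^* != 0 by rewrite conjC_eq0.
(* The Cayley transform of the real line into the unit circle: the argument of
   z / z^* is twice that of z, and the points z n lie on a vertical line. *)
exists (fun n => z n / (z n)^*) => [m n|n]; last first.
  by rewrite normf_div norm_conjC divff // normr_eq0.
move/eqP; rewrite eqr_div // !zJ => /eqP zz.
have : (m%:R - n%:R) * ('i *+ 2) = 0 :> C.
  transitivity (z m * (1 - n%:R * 'i) - z n * (1 - m%:R * 'i)); last first.
    by rewrite zz subrr.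
  by rewrite /z; ring.
move/eqP; rewrite mulf_eq0 mulrn_eq0 /= (negPf (neq0Ci _)) orbF subr_eq0.
by rewrite eqr_nat => /eqP.
Qed.

Local Open Scope fset_scope.

(** Taking inner products with the u i makes the family free, and it has as many
    members as the dimension. *)
Lemma orthonormal_family_basis (R : realType) (d : nat)
    (u : 'I_d -> 'cV[R[i]]_d) :
  (forall i j, cdot (u i) (u j) = (i == j)%:R) ->
  orthonormal_basis [fset u i | i : 'I_d].
Proof.
move=> onu.
have uI : injective u.
  move=> i j uij; apply/eqP; have := onu i i; rewrite {2}uij onu eqxx.
  by case: (i == j) => // /eqP; rewrite eq_sym oner_eq0.
split; last first.
  move=> _ _ /imfsetP[i _ ->] /imfsetP[j _ ->].
  by rewrite onu (inj_eq uI).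
pose X := [tuple u i | i < d].
have -> : basis_of fullv (enum_fset [fset u i | i : 'I_d]) = basis_of fullv X.
  apply: perm_basis; apply: uniq_perm; rewrite ?fset_uniq //.
    by rewrite map_inj_uniq // enum_uniq.
  move=> v; apply/imfsetP/mapP => [[i _ ->]|[i _ ->]]; exists i => //.
  by rewrite mem_enum.
rewrite basisEfree subvf size_tuple dimvf dim_matrix mulr1 leqnn !andbT.
have nthX j : X`_(nat_of_ord j) = u j by rewrite -tnth_nth tnth_mktuple.
apply/freeP=> c c0 i; have := congr1 (cdot (u i)) c0.
under eq_bigr do rewrite nthX.
rewrite cdot_sumr (bigD1 i) //= big1 => [|j ji].
  by rewrite onu eqxx mulr1 addr0 => ->; rewrite /cdot mulmx0 mxE.
by rewrite onu eq_sym (negPf ji) mulr0.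
Qed.

(** Injectivity ensures that the bases form a set of k elements. *)
Lemma mubs_of_mub_family (R : realType) (d k : nat)
    (u : 'I_k -> 'I_d -> 'cV[R[i]]_d) :
  mub_family u -> injective (fun a => [fset u a i | i : 'I_d]) ->
  exists2 S : {fset {fset 'cV[R[i]]_d}},
    #|` S| = k & mutually_unbiased_bases S.
Proof.
move=> [onu unbu] UI.
exists [fset [fset u a i | i : 'I_d] | a : 'I_k].
  by rewrite card_imfset //= -cardE card_ord.
split=> [U /imfsetP[a _ ->]|U V /imfsetP[a _ ->] /imfsetP[b _ ->] UV].
  exact: orthonormal_family_basis.
move=> _ _ /imfsetP[i _ ->] /imfsetP[j _ ->]; apply: unbu.
by apply: contraNneq UV => ->.
Qed.

Lemma mub_family_of_mubs (R : realType) (d k : nat)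
    (S : {fset {fset 'cV[R[i]]_d}}) :
  #|` S| = k -> mutually_unbiased_bases S ->
  exists u : 'I_k -> 'I_d -> 'cV[R[i]]_d, mub_family u.
Proof.
move=> cS [onS unbS].
pose U (a : 'I_k) := nth fset0 (enum_fset S) a.
have US a : U a \in S by apply: mem_nth; rewrite -/(#|` S|) cS.
have sU a : size (enum_fset (U a)) = d.
  have [bU _] := onS _ (US a).
  by rewrite -(@size_basis _ _ _ _ (in_tuple _) bU) dimvf dim_matrix mulr1.
have uU a (i : 'I_d) : nth 0 (enum_fset (U a)) i \in U a.
  by apply: mem_nth; rewrite sU.
exists (fun a i => nth 0 (enum_fset (U a)) i); split=> [a i j|a b i j ab].
  have [_ ->] := onS _ (US a); rewrite ?uU //.
  by rewrite nth_uniq ?sU ?fset_uniq.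
apply: (unbS (U a) (U b)); rewrite ?US ?uU //.
by rewrite nth_uniq ?fset_uniq -?/(#|` S|) ?cS.
Qed.

Lemma mubs_dim1 (R : realType) (k : nat) :
  exists2 S : {fset {fset 'cV[R[i]]_1}},
    #|` S| = k & mutually_unbiased_bases S.
Proof.
have [c cI c1] := @unit_norm_injection R[i].
have cdotc m n : cdot (const_mx (c m)) (const_mx (c n) : 'cV_1) = (c m)^* * c n.
  by rewrite cdotE big_ord1 !mxE.
apply: (@mubs_of_mub_family _ _ _ (fun a _ => const_mx (c a))).
  split=> [a i j|a b i j _].
    by rewrite cdotc (ord1 i) (ord1 j) eqxx mulrC -normCK c1 expr1n.
  by rewrite cdotc normrM norm_conjC !c1 mulr1 sqrtr1 invr1.
move=> a b /= Uab.
have : const_mx (c a) \in [fset (const_mx (c b) : 'cV_1) | j : 'I_1].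
  by rewrite -Uab; apply/imfsetP; exists ord0.
case/imfsetP=> _ _ /matrixP/(_ 0 0); rewrite !mxE => /cI.
exact: val_inj.
Qed.

(** A vector common to two distinct members of the family would have norm 1 and
    also an inner product of modulus 1 / sqrt d < 1 with itself. *)
Lemma mub_family_injective (R : realType) (d k : nat)
    (u : 'I_k -> 'I_d -> 'cV[R[i]]_d) :
  (1 < d)%N -> mub_family u -> injective (fun a => [fset u a i | i : 'I_d]).
Proof.
move=> d1 [onu unbu] a b /= Uab; apply/eqP/negPn/negP=> ab.
pose i0 := Ordinal (ltnW d1).
have : u a i0 \in [fset u b j | j : 'I_d].
  by rewrite -Uab; apply/imfsetP; exists i0.
case/imfsetP=> j _ uE; have := unbu _ _ i0 j ab.
rewrite -uE onu eqxx normr1 -(rmorph1 (real_complex R)) => /complexI/esym/eqP.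
rewrite invr_eq1 => /eqP s1; have := sqr_sqrtr (ler0n R d).
by rewrite s1 expr1n => /esym/eqP; rewrite pnatr_eq1 gtn_eqF.
Qed.

Theorem proposition6p14 (R : realType) (d k : nat)
    (hd : (0 < d)%N) (hk : (0 < k)%N) :
  (exists2 S : {fset {fset 'cV[R[i]]_d}},
     #|` S| = k & mutually_unbiased_bases S)
  <-> is_psd_phaseless_rank (mub_matrix R d k) d.
Proof.
split=> [[S cS mS]|[[B pB rB] _]].
  have [u mu] := mub_family_of_mubs cS mS.
  exact: (phaseless_rank_of_mub_family (Ordinal hk) mu).
have [d1|] := ltnP 1 d; last first.
  move=> d1; have -> : d = 1%N by apply/eqP; rewrite eqn_leq d1 hd.
  exact: mubs_dim1.
have [|u mu] := mub_family_of_phasing (Ordinal hk) pB; first by rewrite rB.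
exact: (mubs_of_mub_family mu (mub_family_injective d1 mu)).
Qed.
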